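(* Let $\mathcal T=[\mathbf A,\mathbf B,\mathbf C]_R$ with $\mathbf A\in\mathbb F^{I\times R}$, $\mathbf B\in\mathbb F^{J\times R}$, $\mathbf C\in\mathbb F^{K\times R}$, and suppose $$k_{\mathbf A}+r_{\mathbf B}+r_{\mathbf C}\ge 2R+2,\qquad r_{\mathbf A}+k_{\mathbf B}+r_{\mathbf C}\ge 2R+2,\qquad r_{\mathbf A}+r_{\mathbf B}+k_{\mathbf C}\ge 2R+2.$$ Then $r_{\mathcal T}=R$ and the CPD of $\mathcal T$ is unique.
   Context: $\mathbb F$ is $\mathbb R$ or $\mathbb C$. For matrices $\mathbf A,\mathbf B,\mathbf C$ with $R$ nonzero columns each, $[\mathbf A,\mathbf B,\mathbf C]_R:=\sum_{r=1}^R\mathbf a_r\circ\mathbf b_r\circ\mathbf c_r$ ($\circ$ = outer product). The rank $r_{\mathcal T}$ of a tensor is the minimal number of terms in such a representation; a representation with $R=r_{\mathcal T}$ terms is a canonical polyadic decomposition (CPD). The CPD of a tensor $\mathcal T$ of rank $R$ is unique if $\mathcal T=[\mathbf A,\mathbf B,\mathbf C]_R=[\bar{\mathbf A},\bar{\mathbf B},\bar{\mathbf C}]_R$ implies that there are an $R\times R$ permutation matrix $\mathbf\Pi$ and nonsingular diagonal matrices $\mathbf\Lambda_{\mathbf A},\mathbf\Lambda_{\mathbf B},\mathbf\Lambda_{\mathbf C}$ with $\bar{\mathbf A}=\mathbf A\mathbf\Pi\mathbf\Lambda_{\mathbf A}$, $\bar{\mathbf B}=\mathbf B\mathbf\Pi\mathbf\Lambda_{\mathbf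 B}$, $\bar{\mathbf C}=\mathbf C\mathbf\Pi\mathbf\Lambda_{\mathbf C}$, $\mathbf\Lambda_{\mathbf A}\mathbf\Lambda_{\mathbf B}\mathbf\Lambda_{\mathbf C}=\mathbf I_R$. $r_{\mathbf M}$ is the rank of a matrix $\mathbf M$; its $k$-rank $k_{\mathbf M}$ is the largest $k$ such that every set of $k$ columns of $\mathbf M$ is linearly independent. *)

(* Defs.v *)
From HB Require Import structures.
From mathcomp Require Import all_boot all_order all_fingroup all_algebra.
From mathcomp Require Import complex reals.

Set Implicit Arguments.
Unset Strict Implicit.
Unset Printing Implicit Defensive.

Import GRing.Theory.
Local Open Scope ring_scope.

Variant real_or_complex (Re : realType) : fieldType -> Prop :=
  | Real_field : real_or_complex Re Re
  | Complex_field : real_or_complex Re Re[i]%C.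

Definition tensor (F : fieldType) (I J K : nat) : Type :=
  {ffun 'I_I * 'I_J * 'I_K -> F}.

Definition outer (F : fieldType) (I J K : nat)
    (a : 'cV[F]_I) (b : 'cV[F]_J) (c : 'cV[F]_K) :
    {ffun 'I_I * 'I_J * 'I_K -> F} :=
  [ffun p => a p.1.1 0 * b p.1.2 0 * c p.2 0].

Definition nonzero_cols (F : fieldType) (m n : nat) (M : 'M[F]_(m, n)) : Prop :=
  forall j : 'I_n, col j M != 0.

(* T = [A, B, C]_R; the bracket includes the nonzero-column requirement. *)
Definition is_PD (F : fieldType) (I J K R : nat) (T : tensor F I J K)
    (A : 'M[F]_(I, R)) (B : 'M[F]_(J, R)) (C : 'M[F]_(K, R)) : Prop :=
  [/\ nonzero_cols A, nonzero_cols B, nonzero_cols C &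
      T = \sum_(r < R) outer (col r A) (col r B) (col r C)].

Definition has_PD (F : fieldType) (I J K : nat) (T : tensor F I J K)
    (R : nat) : Prop :=
  exists (A : 'M[F]_(I, R)) (B : 'M[F]_(J, R)) (C : 'M[F]_(K, R)),
    is_PD T A B C.

Definition tensor_rank_is (F : fieldType) (I J K : nat) (T : tensor F I J K)
    (R : nat) : Prop :=
  has_PD T R /\ forall R' : nat, has_PD T R' -> (R <= R')%N.

Definition nonsingular_diag (F : fieldType) (n : nat) (D : 'M[F]_n) : Prop :=
  is_diag_mx D /\ D \in unitmx.

(* Meaningful when R is the rank of T. *)
Definition CPD_unique (F : fieldType) (I J K : nat) (T : tensor F I J K)
    (R : nat) : Prop :=
  forall (A A' : 'M[F]_(I, R)) (B B' : 'M[F]_(J, R)) (C C' : 'M[F]_(K, R)),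
    is_PD T A B C -> is_PD T A' B' C' ->
    exists P LA LB LC : 'M[F]_R,
      [/\ is_perm_mx P,
          [/\ nonsingular_diag LA, nonsingular_diag LB & nonsingular_diag LC],
          [/\ A' = A *m P *m LA, B' = B *m P *m LB & C' = C *m P *m LC] &
          LA *m LB *m LC = 1%:M].

(* [free] is applied to the columns as a list, so two equal columns in
   different positions count as dependent.  The range stops at n because the
   condition is vacuous for k > n. *)
Definition krank (F : fieldType) (m n : nat) (M : 'M[F]_(m, n)) : nat :=
  \max_(k < n.+1 | [forall S : {set 'I_n},
                      (#|S| == k) ==> free [seq col j M | j in S]]) k.

(* Main.v *)
Require Import Defs.
From HB Require Import structures.
From mathcomp Require Import all_boot all_order all_fingroup all_algebra.
From mathcomp Require Import complex reals.
From mathcomp Require Import zify ring.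

Set Implicit Arguments.
Unset Strict Implicit.
Unset Printing Implicit Defensive.

Import GRing.Theory.
Local Open Scope ring_scope.

(** If two decompositions agree, moving everything to one side gives rank-one
   terms [a_i (x) b_i (x) c_i] that sum to zero.  Suppose that this holds over an
   index set [E] and that no proper nonempty subfamily sums to zero.  Then the
   vectors [b_i (x) c_i] do not split into two subfamilies with independent spans,
   so they span at least [rk E B^T + rk E C^T - 1] dimensions; and the vanishing
   sum bounds [rk E A^T] plus this dimension by [#|E|].  The rank hypotheses
   violate the resulting bound [rk E A^T + rk E B^T + rk E C^T <= #|E| + 1] as soon
   as [E] holds at least two terms of the given decomposition and no more terms
   of the other one.  Such a sum therefore splits, and splitting repeatedly pairs
   off the terms of the two decompositions one by one.  This is the argument of
   Lovitz and Petrov ("A generalization of Kruskal's theorem on tensor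
   decomposition"), with a maximal subfamily in place of a matroid ear
   decomposition. *)

(** * Coordinate restrictions and ranks of row subfamilies *)

Definition restr (F : fieldType) (N : nat) (E : {set 'I_N}) : 'M[F]_N :=
  diag_mx (\row_i (i \in E)%:R).

(** Rows outside [E] are zeroed rather than deleted, so all subfamilies share one matrix type.
    Factor matrices enter transposed, their columns becoming rows. *)
Definition rk (F : fieldType) (N n : nat) (E : {set 'I_N}) (M : 'M[F]_(N, n)) :=
  \rank (restr F E *m M).

Lemma restr_mulE (F : fieldType) (N n : nat) (E : {set 'I_N}) (M : 'M[F]_(N, n)) i j :
  (restr F E *m M) i j = (i \in E)%:R * M i j.
Proof. by rewrite mul_diag_mx !mxE. Qed.

Lemma mul_restrE (F : fieldType) (N n : nat) (E : {set 'I_N}) (M : 'M[F]_(n, N)) i j :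
  (M *m restr F E) i j = M i j * (j \in E)%:R.
Proof. by rewrite mul_mx_diag !mxE. Qed.

Lemma tr_restr (F : fieldType) (N : nat) (E : {set 'I_N}) :
  (restr F E)^T = restr F E.
Proof. exact: tr_diag_mx. Qed.

Lemma restrI (F : fieldType) (N : nat) (E S : {set 'I_N}) :
  restr F E *m restr F S = restr F (E :&: S).
Proof.
apply/matrixP=> i j; rewrite restr_mulE !mxE inE.
by case: (i \in E); rewrite ?mul1r // mul0r mul0rn.
Qed.

Lemma restrS (F : fieldType) (N : nat) (E S : {set 'I_N}) : S \subset E ->
  restr F S *m restr F E = restr F S.
Proof. by move=> sSE; rewrite restrI (setIidPl sSE). Qed.

Lemma restrU (F : fieldType) (N : nat) (E S : {set 'I_N}) : [disjoint E & S] ->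
  restr F (E :|: S) = restr F E + restr F S.
Proof.
move=> dES; apply/matrixP=> i j; rewrite !mxE inE -mulrnDl -natrD.
by case: (boolP (i \in E)) => //= iE; rewrite (disjointFr dES iE).
Qed.

Lemma restrT (F : fieldType) (N : nat) : restr F [set: 'I_N] = 1%:M.
Proof. by apply/matrixP=> i j; rewrite !mxE inE. Qed.

Lemma restr0 (F : fieldType) (N : nat) : restr F (set0 : {set 'I_N}) = 0.
Proof. by apply/matrixP=> i j; rewrite !mxE inE mul0rn. Qed.

Lemma mul_restr1 (F : fieldType) (N n : nat) (v : 'rV[F]_N) (M : 'M[F]_(N, n)) i :
  v *m restr F [set i] *m M = v 0 i *: row i M.
Proof.
rewrite rowE scalemxAl; congr (_ *m _); apply/rowP=> j.
rewrite mul_restrE !mxE inE eqxx /=.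
by case: (eqVneq j i) => [->|]; rewrite ?mulr0.
Qed.

Lemma restr_sub (F : fieldType) (N n : nat) (S E : {set 'I_N}) (M : 'M[F]_(N, n)) :
  S \subset E -> (restr F S *m M <= restr F E *m M)%MS.
Proof. by move=> sSE; rewrite -(restrS F sSE) -mulmxA submxMl. Qed.

Lemma rkS (F : fieldType) (N n : nat) (S E : {set 'I_N}) (M : 'M[F]_(N, n)) :
  S \subset E -> (rk S M <= rk E M)%N.
Proof. by move=> sSE; apply/mxrankS/restr_sub. Qed.

Lemma rkU (F : fieldType) (N n : nat) (S E : {set 'I_N}) (M : 'M[F]_(N, n)) :
  [disjoint S & E] -> (rk (S :|: E) M <= rk S M + rk E M)%N.
Proof. by move=> d; rewrite /rk restrU // mulmxDl mxrank_add. Qed.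

Lemma restrU_eqmx (F : fieldType) (N n : nat) (S E : {set 'I_N}) (M : 'M[F]_(N, n)) :
  [disjoint S & E] ->
  (restr F (S :|: E) *m M :=: restr F S *m M + restr F E *m M)%MS.
Proof.
move=> d; apply/eqmxP/andP; split.
  by rewrite restrU // mulmxDl addmx_sub // ?addsmxSl ?addsmxSr.
by rewrite addsmx_sub !restr_sub ?subsetUl ?subsetUr.
Qed.

Lemma rank_restr_le (F : fieldType) (N : nat) (E : {set 'I_N}) :
  (\rank (restr F E) <= #|E|)%N.
Proof.
rewrite -sum1_card /restr diag_mx_sum_delta [X in (_ <= X)%N]big_mkcond /=.
elim/big_rec2: _ => [|i m X _ leX]; first by rewrite mxrank0.
apply: leq_trans (mxrank_add _ _) (leq_add _ leX); rewrite mxE.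
by case: (i \in E); rewrite ?scale0r ?mxrank0 // scale1r mxrank_delta.
Qed.

Lemma rank_restr (F : fieldType) (N : nat) (E : {set 'I_N}) :
  \rank (restr F E) = #|E|.
Proof.
apply/eqP; rewrite eqn_leq rank_restr_le /=.
(* The restrictions to [E] and to its complement add up to the identity, so neither rank can fall
   short of its upper bound. *)
rewrite -(leq_add2r #|~: E|) cardsC card_ord -{1}(mxrank1 F N) -(restrT F N).
rewrite -(setUCr E) restrU; last by rewrite -setI_eq0 setICr.
by apply: leq_trans (mxrank_add _ _) _; rewrite leq_add2l rank_restr_le.
Qed.

Lemma rk_le_card (F : fieldType) (N n : nat) (E : {set 'I_N}) (M : 'M[F]_(N, n)) :
  (rk E M <= #|E|)%N.
Proof. by rewrite -(rank_restr F) mxrankM_maxl. Qed.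

Lemma rk_le_addD (F : fieldType) (N n : nat) (S E : {set 'I_N}) (M : 'M[F]_(N, n)) :
  S \subset E -> (rk E M <= rk S M + #|E :\: S|)%N.
Proof.
move=> sSE; rewrite -{1}(setID E S) (setIidPr sSE).
apply: leq_trans (rkU _ _) _; last by rewrite leq_add2l rk_le_card.
by rewrite -setI_eq0 setIDA setDIl setDv set0I.
Qed.

Lemma rkT (F : fieldType) (N n : nat) (M : 'M[F]_(N, n)) : rk setT M = \rank M.
Proof. by rewrite /rk restrT mul1mx. Qed.

Lemma restrD1 (F : fieldType) (N : nat) (E : {set 'I_N}) i : i \in E ->
  restr F E = restr F (E :\ i) + restr F [set i].
Proof.
move=> iE; rewrite -restrU; first by rewrite setUC setD1K.
by rewrite disjoint_sym disjoints1 !inE eqxx.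
Qed.

(** Since the coefficient at [i] is nonzero, row [i] can be solved for in terms of the other rows of
    [E]. *)
Lemma restr_sub_exchange (F : fieldType) (N n : nat) (E : {set 'I_N}) i
    (v : 'rV[F]_N) (M : 'M[F]_(N, n)) :
  i \in E -> v 0 i != 0 ->
  (v *m restr F E *m M <= restr F (E :\ i) *m M)%MS ->
  (restr F E *m M <= restr F (E :\ i) *m M)%MS.
Proof.
move=> iE nzvi; rewrite (restrD1 F iE) mulmxDr !mulmxDl mul_restr1 => le_v.
have le_i : (row i M <= restr F (E :\ i) *m M)%MS.
  have opp_sub : (- (v *m restr F (E :\ i) *m M) <= restr F (E :\ i) *m M)%MS.
    by rewrite eqmx_opp -mulmxA submxMl.
  by move: (addmx_sub le_v opp_sub); rewrite addrC addKr eqmx_scale.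
apply: addmx_sub => //; apply/row_subP=> j.
by rewrite row_mul rowE mul_restr1 scalemx_sub.
Qed.

Lemma rk_independent (F : fieldType) (N n : nat) (E : {set 'I_N}) (M : 'M[F]_(N, n)) :
  (forall v : 'rV[F]_N, v *m restr F E = v -> v *m M = 0 -> v = 0) ->
  rk E M = #|E|.
Proof.
move=> inj; rewrite -(rank_restr F) -(mxrank_mul_ker _ M) /rk.
suff /eqP-> : (restr F E :&: kermx M)%MS == 0 by rewrite mxrank0 addn0.
apply/rowV0P=> v; rewrite sub_capmx sub_kermx => /andP[/submxP[w ->] /eqP].
by apply: inj; rewrite -mulmxA restrS.
Qed.

(** Rank-nullity: the rows of [X^T *m restr F E] lie in the left kernel of [Y] inside the coordinate
    space of [E], a space of dimension [#|E| - rk E Y]. *)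
Lemma rk_dual (F : fieldType) (N m n : nat) (E : {set 'I_N})
    (X : 'M[F]_(N, m)) (Y : 'M[F]_(N, n)) :
  X^T *m restr F E *m Y = 0 -> (rk E X + rk E Y <= #|E|)%N.
Proof.
move=> XY0; rewrite -(rank_restr F) -(mxrank_mul_ker _ Y) addnC leq_add2l.
rewrite /rk -mxrank_tr mxrankS // sub_capmx sub_kermx trmx_mul tr_restr.
by rewrite submxMl XY0 eqxx.
Qed.

(** * Row-wise Khatri-Rao products *)

Definition khatri_rao (F : fieldType) (N J K : nat)
    (B : 'M[F]_(N, J)) (C : 'M[F]_(N, K)) : 'M[F]_(N, J * K) :=
  \matrix_i mxvec ((row i B)^T *m row i C).

Lemma khatri_raoE (F : fieldType) (N J K : nat)
    (B : 'M[F]_(N, J)) (C : 'M[F]_(N, K)) i j k :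
  khatri_rao B C i (mxvec_index j k) = B i j * C i k.
Proof. by rewrite mxE mxvecE mxE big_ord1 !mxE. Qed.

(** Turns linear relations among the product vectors into matrix identities, the form in which
    [rk_ear] uses them. *)
Lemma mul_khatri_rao (F : fieldType) (N J K : nat)
    (B : 'M[F]_(N, J)) (C : 'M[F]_(N, K)) (v : 'rV[F]_N) :
  v *m khatri_rao B C = mxvec (B^T *m diag_mx v *m C).
Proof.
apply/rowP=> jk; case/mxvec_indexP: jk => j k; rewrite mxvecE !mxE.
apply: eq_bigr => i _; rewrite khatri_raoE mul_mx_diag !mxE.
by rewrite mulrA [v _ _ * _]mulrC.
Qed.

Lemma diag_mx_mul_restr (F : fieldType) (N : nat) (v : 'rV[F]_N) (E : {set 'I_N}) :
  diag_mx (v *m restr F E) = diag_mx v *m restr F E.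
Proof.
apply/matrixP=> i j; rewrite mul_restrE mxE mul_restrE !mxE mulrnAl.
by case: (eqVneq i j) => [->|].
Qed.

(* A relation between [S] and [Q] whose two sides do not vanish costs one
   dimension: projecting it modulo the [B]-span of [S] bounds the growth of the
   [B]-rank, and its common value lies in both [C]-spans. *)
Lemma rk_ear (F : fieldType) (N J K : nat) (S Q : {set 'I_N})
    (B : 'M[F]_(N, J)) (C : 'M[F]_(N, K)) (u v : 'rV[F]_N) :
  [disjoint S & Q] -> (forall i, u 0 i != 0) ->
  B^T *m (diag_mx u *m restr F Q) *m C = B^T *m (diag_mx v *m restr F S) *m C ->
  B^T *m (diag_mx u *m restr F Q) *m C != 0 ->
  (rk (S :|: Q) B + rk (S :|: Q) C + 1 <= rk S B + rk S C + #|Q|)%N.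
Proof.
move=> dSQ nzu eq_uv nz.
have uU : diag_mx u \in unitmx.
  by rewrite unitmxE unitfE det_diag; apply/prodf_neq0 => i _.
have comm (w : 'rV[F]_N) E : diag_mx w *m restr F E = restr F E *m diag_mx w.
  by rewrite diag_mxC.
have capC : (0 < \rank (restr F S *m C :&: restr F Q *m C)%MS)%N.
  rewrite lt0n mxrank_eq0; apply: contraNneq nz => cap0.
  rewrite -submx0 -cap0 sub_capmx {1}eq_uv -!mulmxA.
  by rewrite (mulmxA B^T) submxMl (mulmxA B^T) submxMl.
have := mxrank_sum_cap (restr F S *m C) (restr F Q *m C).
have := mxrank_sum_cap (restr F S *m B) (restr F Q *m B).
rewrite -!(restrU_eqmx _ dSQ) -!/(rk _ _) => rkB rkC.
(* [P] is the quotient by the [B]-span of [S], so [rk Q (B *m P)] is exactly what [Q] adds to the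
   [B]-rank. *)
pose P := cokermx (restr F S *m B).
have := mxrank_mul_ker (restr F Q *m B) P.
have -> : \rank (restr F Q *m B :&: kermx P) =
          \rank (restr F S *m B :&: restr F Q *m B).
  have eqP_ : (kermx P :=: restr F S *m B)%MS.
    by apply/eqmxP; rewrite submxE mulmx_ker eqxx sub_kermx mulmx_coker eqxx.
  by rewrite (cap_eqmx (eqmx_refl _) eqP_) capmxC.
rewrite -/(rk Q B) -mulmxA -/(rk Q (B *m P)) => rkBP.
have SP0 : restr F S *m (B *m P) = 0 by rewrite mulmxA mulmx_coker.
(* Multiplied by [P^T], the side of [S] vanishes, which leaves an orthogonality relation over [Q]
   alone. *)
have: (rk Q (B *m P) + rk Q (diag_mx u *m C) <= #|Q|)%N.
  apply: rk_dual; move: P SP0 {rkBP} => P /(congr1 trmx).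
  rewrite !trmx_mul tr_restr trmx0 => PS0.
  have /(congr1 (mulmx P^T)) := eq_uv.
  by rewrite (comm u Q) (comm v S) !mulmxA PS0 !mul0mx.
have -> : rk Q (diag_mx u *m C) = rk Q C.
  rewrite /rk mulmxA -comm -mulmxA; apply/eqmx_rank/eqmxP/eqmxMfull.
  by rewrite row_full_unit.
lia.
Qed.

(** A single index satisfies the bound. Adding a minimal [Q] raises the rank of the product vectors
    by at least [#|Q| - 1], and by [rk_ear] the sum of the [B]- and [C]-ranks by at most [#|Q| - 1],
    so the bound persists until [E] is exhausted. *)
Lemma rk_khatri_rao_connected (F : fieldType) (N J K : nat) (E : {set 'I_N})
    (B : 'M[F]_(N, J)) (C : 'M[F]_(N, K)) :
  E != set0 -> (forall i, i \in E -> row i (khatri_rao B C) != 0) ->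
  (forall S, S != set0 -> S \proper E ->
     (restr F S *m khatri_rao B C :&: restr F (E :\: S) *m khatri_rao B C)%MS != 0) ->
  (rk E B + rk E C <= rk E (khatri_rao B C) + 1)%N.
Proof.
move=> /set0Pn[i0 i0E] nzW conn.
set W := khatri_rao B C in nzW conn *.
pose good (S : {set 'I_N}) :=
  [&& S != set0, S \subset E & (rk S B + rk S C <= rk S W + 1)%N].
have good1 : good [set i0].
  apply/and3P; split; rewrite ?sub1set //; first by apply/set0Pn; exists i0; rewrite inE.
  have: (0 < rk [set i0] W)%N.
    rewrite lt0n mxrank_eq0; apply: contraNneq (nzW _ i0E) => W0.
    have := mul_restr1 (delta_mx 0 i0) W i0.
    by rewrite -mulmxA W0 mulmx0 mxE !eqxx scale1r => <-.
  have := rk_le_card [set i0] B; have := rk_le_card [set i0] C.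
  by rewrite cards1 => ? ? ?; lia.
(* Take [S] maximal with the bound; if [S] is proper, a minimal [Q] whose span
   meets that of [S] is independent and extends [S] keeping the bound. *)
have [S maxS _] := maxset_exists good1.
have /and3P[nzS sSE goodS] := maxsetp maxS.
have [<- // | neSE] := eqVneq S E.
have pSE : S \proper E by rewrite properEneq neSE.
pose meets (Q : {set 'I_N}) :=
  (Q \subset E :\: S) && ((restr F S *m W :&: restr F Q *m W)%MS != 0).
have meetsD : meets (E :\: S) by rewrite /meets subxx conn.
have [Q minQ _] := minset_exists meetsD.
have /andP[sQ capQ] := minsetp minQ.
have dSQ : [disjoint S & Q].
  by move: sQ; rewrite subsetD disjoint_sym => /andP[].
have capD1 i : i \in Q -> (restr F S *m W :&: restr F (Q :\ i) *m W)%MS = 0.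
  move=> iQ; apply/eqP; apply: contraT => cap_n0.
  have/(minsetinf minQ)/(_ (subD1set _ _))/setP/(_ i) : meets (Q :\ i).
    by rewrite /meets cap_n0 andbT (subset_trans (subD1set _ _)).
  by rewrite !inE eqxx iQ.
have [iQ iQQ] : exists i, i \in Q.
  apply/set0Pn; apply: contraNneq capQ => ->.
  by rewrite restr0 mul0mx capmx0.
(* A dependency among the rows of [Q] would allow one index to be dropped without shrinking the
   span, against minimality. *)
have rkQ : rk Q W = #|Q|.
  apply: rk_independent => v vQ vW0; apply/eqP; apply: contraT => /rV0Pn[i nzvi].
  have iQ' : i \in Q.
    by apply: contraNT nzvi => /negPf niQ; rewrite -vQ mul_restrE niQ mulr0.
  have sQi : (restr F Q *m W <= restr F (Q :\ i) *m W)%MS.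
    by apply: restr_sub_exchange nzvi _ => //; rewrite vQ vW0 sub0mx.
  by move: capQ; rewrite -submx0 -(capD1 i) // capmxS.
(* Without [iQ] the two spans are in direct sum, so only one dimension can be lost. *)
have rkSQ : (rk S W + #|Q| <= rk (S :|: Q) W + 1)%N.
  have dSQi : [disjoint S & Q :\ iQ] by rewrite (disjointWr _ dSQ) ?subD1set.
  have rkD : rk (S :|: Q :\ iQ) W = (rk S W + rk (Q :\ iQ) W)%N.
    by rewrite /rk (restrU_eqmx _ dSQi) mxrank_disjoint_sum // capD1.
  have := rkS W (setUS S (subD1set Q iQ)); rewrite rkD => le_rk.
  have := rk_le_addD W (subD1set Q iQ).
  rewrite setDDr setDv set0U (setIidPr _) ?sub1set // cards1 -rkQ => leQ.
  by apply: leq_trans (leq_add (leqnn _) leQ) _; rewrite addnA leq_add2r.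
have rkE : (rk (S :|: Q) B + rk (S :|: Q) C + 1 <= rk S B + rk S C + #|Q|)%N.
  have /rowV0Pn[w] := capQ.
  rewrite sub_capmx => /andP[/submxP[v wv] wQ] nzw.
  have /submxP[u wu] := wQ.
  (* [rk_ear] wants coefficients that vanish nowhere; outside [Q] their value is immaterial, so 1 is
     used. *)
  pose u' : 'rV[F]_N := \row_i (if i \in Q then u 0 i else 1).
  have uE : u' *m restr F Q = u *m restr F Q.
    apply/rowP=> i; rewrite !mul_restrE mxE.
    by case: ifP => // _; rewrite !mulr0.
  have rel (x : 'rV[F]_N) X : w = x *m (restr F X *m W) ->
      B^T *m (diag_mx x *m restr F X) *m C = vec_mx w.
    by move=> ->; rewrite [x *m (_ *m W)]mulmxA mul_khatri_rao mxvecK diag_mx_mul_restr.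
  have wu' : w = u' *m (restr F Q *m W) by rewrite mulmxA uE -mulmxA.
  apply: (@rk_ear _ _ _ _ _ _ _ _ u' v) => //.
  (* A zero coefficient inside [Q] would put [w] in the span of [Q :\ i], which meets that of [S]
     trivially. *)
  - move=> i; rewrite mxE; case: ifP => [iQ'|_]; last exact: oner_neq0.
    apply: contraNneq nzw => ui0; rewrite -submx0 -(capD1 i) // sub_capmx.
    rewrite {1}wv submxMl wu mulmxA (restrD1 F iQ') mulmxDr mulmxDl mul_restr1 ui0.
    by rewrite scale0r addr0 -mulmxA submxMl.
  - by rewrite (rel _ _ wu') (rel _ _ wv).
  - by rewrite (rel _ _ wu'); apply: contraNneq nzw => w0; rewrite -[w]vec_mxK w0 linear0.
have goodSQ : good (S :|: Q).
  apply/and3P; split.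
  - by apply: contraNneq nzS => SQ0; rewrite -subset0 -SQ0 subsetUl.
  - by rewrite subUset sSE (subset_trans sQ) ?subsetDl.
  - have arith (b c b' c' w w' q : nat) : (b + c <= w + 1 -> w + q <= w' + 1 ->
        b' + c' + 1 <= b + c + q -> b' + c' <= w' + 1)%N by clear; lia.
    exact: arith goodS rkSQ rkE.
have /setP/(_ iQ) := maxsetsup maxS goodSQ (subsetUl _ _).
by rewrite inE iQQ orbT (disjointFl dSQ iQQ).
Qed.

(** * Vanishing sums of rank-one terms *)

Definition term (F : fieldType) (I J K N : nat)
    (A : 'M[F]_(I, N)) (B : 'M[F]_(J, N)) (C : 'M[F]_(K, N)) (i : 'I_N) :
    {ffun 'I_I * 'I_J * 'I_K -> F} :=
  outer (col i A) (col i B) (col i C).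

(** Mode-one unfolding: flattening the last two indices turns a partial sum into a matrix
    product. *)
Lemma sum_termE (F : fieldType) (I J K N : nat) (S : {set 'I_N})
    (A : 'M[F]_(I, N)) (B : 'M[F]_(J, N)) (C : 'M[F]_(K, N)) p j k :
  (\sum_(i in S) term A B C i) (p, j, k)
  = (A *m restr F S *m khatri_rao B^T C^T) p (mxvec_index j k).
Proof.
rewrite sum_ffunE [in RHS]mxE big_mkcond; apply: eq_bigr => i _.
rewrite mul_restrE khatri_raoE !ffunE !mxE.
case: (i \in S); first by rewrite mulr1 mulrA.
by rewrite mulr0 mul0r.
Qed.

Lemma sum_term_eq0 (F : fieldType) (I J K N : nat) (S : {set 'I_N})
    (A : 'M[F]_(I, N)) (B : 'M[F]_(J, N)) (C : 'M[F]_(K, N)) :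
  (\sum_(i in S) term A B C i == 0) = (A *m restr F S *m khatri_rao B^T C^T == 0).
Proof.
apply/idP/idP => /eqP => [sum0 | AW0]; apply/eqP.
  apply/matrixP=> p jk; case/mxvec_indexP: jk => j k.
  by rewrite -sum_termE sum0 ffunE mxE.
by apply/ffunP=> -[[p j] k]; rewrite sum_termE AW0 ffunE mxE.
Qed.

Lemma rk_minimal_vanishing (F : fieldType) (I J K N : nat) (E : {set 'I_N})
    (A : 'M[F]_(I, N)) (B : 'M[F]_(J, N)) (C : 'M[F]_(K, N)) :
  E != set0 -> (forall i, i \in E -> term A B C i != 0) ->
  \sum_(i in E) term A B C i = 0 ->
  (forall S, S != set0 -> S \proper E -> \sum_(i in S) term A B C i != 0) ->
  (rk E A^T + rk E B^T + rk E C^T <= #|E| + 1)%N.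
Proof.
move=> nzE nz_term /eqP; rewrite sum_term_eq0 => /eqP sumE minE.
have rkA : (rk E A^T + rk E (khatri_rao B^T C^T) <= #|E|)%N.
  by apply: rk_dual; rewrite trmxK.
have : (rk E B^T + rk E C^T <= rk E (khatri_rao B^T C^T) + 1)%N.
  apply: rk_khatri_rao_connected => // [i iE | S nzS pSE].
    apply: contraNneq (nz_term i iE) => /rowP W0; apply/eqP/ffunP=> -[[p j] k].
    have := W0 (mxvec_index j k); rewrite mxE khatri_raoE !ffunE !mxE /=.
    by rewrite -mulrA => ->; rewrite mulr0.
  (* The sum over [S] is minus the sum over [E :\: S], so its unfolded rows lie in both spans and
     would vanish if these met trivially. *)
  apply: contraNneq (minE S nzS pSE) => cap0; rewrite sum_term_eq0 -submx0 -cap0.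
  have sSE := proper_sub pSE.
  have sumSD : A *m restr F S *m khatri_rao B^T C^T
             = - (A *m restr F (E :\: S) *m khatri_rao B^T C^T).
    apply/eqP; rewrite -addr_eq0 -mulmxDl -mulmxDr -restrU; last first.
      by rewrite disjoints_subset setDE setCI setCK subsetUr.
    by rewrite -{1}(setIidPr sSE) setID sumE.
  by rewrite sub_capmx {2}sumSD eqmx_opp -!mulmxA !submxMl.
move: rkA; clear; lia.
Qed.

(** Strong induction on [#|E|]. After a split, one half has no more indices outside [L] than inside;
    induction balances it exactly, which forces the inequality on the other half. Values are counted
    with multiplicity because terms may repeat. *)
Lemma balanced_vanishing (T : finType) (V : zmodType) (z : T -> V) (L : {set T}) :
  (forall i, z i != 0) ->
  (forall E : {set T}, \sum_(i in E) z i = 0 -> (1 < #|E :&: L|)%N ->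
     (#|E :\: L| <= #|E :&: L|)%N ->
     exists S : {set T}, [/\ S != set0, S \proper E & \sum_(i in S) z i = 0]) ->
  forall E : {set T}, \sum_(i in E) z i = 0 -> (#|E :\: L| <= #|E :&: L|)%N ->
    #|E :\: L| = #|E :&: L| /\
    forall t, (\sum_(i in E :&: L) (z i == t) = \sum_(i in E :\: L) (z i == - t)%R)%N.
Proof.
move=> nz split E; have [m] := ubnP #|E|.
elim: m E => // m IHm E; rewrite ltnS => leEm sumE leE.
have [card_le1 | card_gt1] := leqP #|E :&: L| 1.
  have [/eqP | card_neq0] := posnP #|E :&: L|.
    move=> E0; move: leE; rewrite (eqP E0) leqn0 => D0.
    rewrite (eqP D0); split=> // t.
    by move: E0 D0; rewrite !cards_eq0 => /eqP-> /eqP->; rewrite !big_set0.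
  have /cards1P[i Ei] : #|E :&: L| == 1%N by rewrite eqn_leq card_le1.
  move: sumE leE; rewrite (big_setID L) /= Ei cards1 big_set1.
  case: (posnP #|E :\: L|) => [/eqP|D_gt0 sum_i D_le1].
    rewrite cards_eq0 => /eqP->; rewrite big_set0 addr0 => /eqP.
    by rewrite (negPf (nz i)).
  have /cards1P[j Ej] : #|E :\: L| == 1%N by rewrite eqn_leq D_le1.
  move: sum_i; rewrite Ej cards1 big_set1 => /eqP; rewrite addr_eq0 => /eqP zi.
  by split=> // t; rewrite !big_set1 zi eqr_oppLR.
have [S [nzS pSE sumS]] := split _ sumE card_gt1 leE.
have sSE := proper_sub pSE.
pose S' := E :\: S.
have cardI : #|E :&: L| = (#|S :&: L| + #|S' :&: L|)%N.
  by rewrite /S' -(cardsID S) setIAC (setIidPr sSE) setIDAC.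
have cardD : #|E :\: L| = (#|S :\: L| + #|S' :\: L|)%N.
  by rewrite /S' -(cardsID S) setIDAC (setIidPr sSE) !setDDl setUC.
have sumS' : \sum_(i in S') z i = 0.
  by move: sumE; rewrite (big_setID S) /= (setIidPr sSE) sumS add0r.
have ltS : (#|S| < m)%N by apply: leq_trans (proper_card pSE) leEm.
have ltS' : (#|S'| < m)%N.
  apply: leq_trans leEm; rewrite cardsD (setIidPr sSE) ltn_subrL card_gt0 nzS /=.
  by apply: leq_trans (proper_card pSE).
have combine : (#|S :\: L| <= #|S :&: L|)%N -> (#|S' :\: L| <= #|S' :&: L|)%N ->
    #|E :\: L| = #|E :&: L| /\
    forall t, (\sum_(i in E :&: L) (z i == t) = \sum_(i in E :\: L) (z i == - t)%R)%N.
  move=> /(IHm _ ltS sumS)[cS eqS] /(IHm _ ltS' sumS')[cS' eqS'].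
  split=> [|t]; first by rewrite cardI cardD cS cS'.
  rewrite (big_setID S) [RHS](big_setID S) /= setIAC (setIidPr sSE).
  rewrite -[_ :&: L :\: S]setIDAC eqS.
  by rewrite [(_ :\: L) :&: S]setIDAC (setIidPr sSE) setDDl [L :|: S]setUC -setDDl eqS'.
have [leS | gtS] := leqP #|S :\: L| #|S :&: L|.
  have [cS _] := IHm _ ltS sumS leS; apply: combine => //.
  by move: leE; rewrite cardI cardD cS leq_add2l.
have leS' : (#|S' :\: L| <= #|S' :&: L|)%N.
  have := leq_trans leE (leqnn _); rewrite cardI cardD; move: gtS; clear; lia.
have [cS' _] := IHm _ ltS' sumS' leS'.
by move: leE; rewrite cardI cardD cS' leq_add2r leqNgt gtS.
Qed.

(** * Ranks of column subsets from rank and k-rank *)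

Lemma rk_free (F : fieldType) (m n : nat) (S : {set 'I_n}) (M : 'M[F]_(m, n)) :
  free [seq col j M | j in S] -> rk S M^T = #|S|.
Proof.
move=> /(@freeP _ _ #|S| [tuple of [seq col j M | j in S]]) freeS.
apply: rk_independent => v vS vM0; apply/rowP=> j; rewrite mxE.
have [jS | /negPf njS] := boolP (j \in S); last first.
  by rewrite -vS mul_restrE njS mulr0.
rewrite -(enum_rankK_in jS jS).
apply: (freeS (fun i => v 0 (enum_val i))).
under eq_bigr => i _ do rewrite nth_image.
rewrite -(big_enum_val (fun j => v 0 j *: col j M)).
rewrite -[RHS](trmx0 F) -vM0; apply/colP=> p; rewrite summxE !mxE big_mkcond.
apply: eq_bigr => i _; rewrite !mxE -vS mul_restrE.
by case: (i \in S); rewrite ?mulr1 // mulr0 mul0r.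
Qed.

Lemma exists_subset_card (T : finType) (X : {set T}) k :
  (k <= #|X|)%N -> exists2 S : {set T}, S \subset X & #|S| = k.
Proof.
rewrite -bin_gt0 -cards_draws card_gt0 => /set0Pn[S].
by rewrite inE => /andP[sSX /eqP cS]; exists S.
Qed.

Lemma rk_krank (F : fieldType) (m n : nat) (X : {set 'I_n}) (M : 'M[F]_(m, n)) :
  (minn (krank M) #|X| <= rk X M^T)%N.
Proof.
pose P (k : 'I_n.+1) := [forall S : {set 'I_n},
  (#|S| == k) ==> free [seq col j M | j in S]].
have P0 : (0 < #|P|)%N.
  apply/card_gt0P; exists ord0; apply/forallP=> S; apply/implyP.
  by rewrite cards_eq0 => /eqP->; rewrite /image_mem enum_set0 nil_free.
have [k /forallP Pk krankE] := eq_bigmax_cond (@nat_of_ord n.+1) P0.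
rewrite /krank -/(P _) krankE.
have rk_k (S : {set 'I_n}) : #|S| = k -> rk S M^T = k.
  by move=> cS; rewrite rk_free //; have := Pk S; rewrite cS eqxx.
have [leX | ltX] := leqP k #|X|.
  by have [S sSX cS] := exists_subset_card leX; rewrite -(rk_k S cS) rkS.
(* Here [X] is enlarged to an independent set of size [k], the complement of [U]; subsets of it keep
   full rank. *)
have: (n - k <= #|~: X|)%N by rewrite cardsCs card_ord setCK leq_sub2l // ltnW.
move=> /exists_subset_card[U sUX cU].
have cS : #|~: U| = k by rewrite cardsCs card_ord setCK cU subKn // -ltnS.
have sXU : X \subset ~: U by rewrite -setCS setCK.
have := rk_le_addD M^T sXU; rewrite rk_k // cardsD (setIidPr sXU) cS.
by rewrite addnC -leq_subLR subKn // ltnW.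
Qed.

Lemma rank_le_rk (F : fieldType) (m n : nat) (X : {set 'I_n}) (M : 'M[F]_(m, n)) :
  (\rank M + #|X| <= rk X M^T + n)%N.
Proof.
have := rk_le_addD M^T (subsetT X).
rewrite rkT mxrank_tr setTD cardsCs card_ord setCK => le_rk.
have := leq_add le_rk (leqnn #|X|); rewrite -addnA subnK //.
by rewrite -[X in (_ <= X)%N](card_ord n) max_card.
Qed.

(** If some k-rank, say that of [A], is at most [#|X|], it bounds [rk X A^T] below, while [B] and
    [C] each lose at most [R - #|X|] from their ranks; the hypothesis on [krank A] concludes.
    Otherwise all three ranks equal [#|X|], and [3 * #|X|] suffices once [#|X|] is at least 2. *)
Lemma rk_subset_bound (F : fieldType) (I J K R : nat)
    (A : 'M[F]_(I, R)) (B : 'M[F]_(J, R)) (C : 'M[F]_(K, R)) :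
  (2 * R + 2 <= krank A + \rank B + \rank C)%N ->
  (2 * R + 2 <= \rank A + krank B + \rank C)%N ->
  (2 * R + 2 <= \rank A + \rank B + krank C)%N ->
  forall X : {set 'I_R}, (1 < #|X|)%N ->
    (2 * #|X| + 2 <= rk X A^T + rk X B^T + rk X C^T)%N.
Proof.
move=> hA hB hC X.
move: (rk_krank X A) (rk_krank X B) (rk_krank X C).
move: (rank_le_rk X A) (rank_le_rk X B) (rank_le_rk X C) hA hB hC.
move: (rk X A^T) (rk X B^T) (rk X C^T) (\rank A) (\rank B) (\rank C).
move: (krank A) (krank B) (krank C) (#|X|); clear; lia.
Qed.

(** * Factors of a rank-one tensor up to scaling *)

Lemma proportional (F : fieldType) (n : nat) (v v' : 'cV[F]_n) i (x x' : F) :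
  v i 0 != 0 -> x' != 0 -> (forall p, v p 0 * x = v' p 0 * x') ->
  v' = (v' i 0 / v i 0) *: v.
Proof.
move=> nzv nzx' eq_v; apply/colP=> p; rewrite mxE; apply: (mulIf nzx').
transitivity (v' i 0 * x' * v p 0 / v i 0); last by ring.
by rewrite -!eq_v; field.
Qed.

Lemma outer_inj (F : fieldType) (I J K : nat) (a a' : 'cV[F]_I) (b b' : 'cV[F]_J)
    (c c' : 'cV[F]_K) :
  a != 0 -> b != 0 -> c != 0 -> outer a b c = outer a' b' c' ->
  exists x : F * F * F, [/\ a' = x.1.1 *: a, b' = x.1.2 *: b, c' = x.2 *: c &
    x.1.1 * x.1.2 * x.2 = 1].
Proof.
move=> /cV0Pn[i nza] /cV0Pn[j nzb] /cV0Pn[k nzc] /ffunP eq_out.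
have eqE p q r : a p 0 * b q 0 * c r 0 = a' p 0 * b' q 0 * c' r 0.
  by have := eq_out (p, q, r); rewrite !ffunE.
have: a' i 0 * b' j 0 * c' k 0 != 0 by rewrite -eqE !mulf_neq0.
rewrite !mulf_eq0 !negb_or -andbA => /and3P[nza' nzb' nzc'].
(* The scalars are ratios at one nonzero entry. Freezing two of its indices gives each
   proportionality; the entry itself gives product 1. *)
exists (a' i 0 / a i 0, b' j 0 / b j 0, c' k 0 / c k 0); split=> /=.
- apply: (@proportional _ _ _ _ _ (b j 0 * c k 0) (b' j 0 * c' k 0)) => // [|p].
    by rewrite mulf_neq0.
  by rewrite !mulrA eqE.
- apply: (@proportional _ _ _ _ _ (a i 0 * c k 0) (a' i 0 * c' k 0)) => // [|p].
    by rewrite mulf_neq0.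
  by rewrite !mulrA -![_ p 0 * _]mulrC eqE.
- apply: (@proportional _ _ _ _ _ (a i 0 * b j 0) (a' i 0 * b' j 0)) => // [|p].
    by rewrite mulf_neq0.
  by rewrite ![_ p 0 * _]mulrC eqE.
- by rewrite !mulf_div -eqE divff // !mulf_neq0.
Qed.

Lemma term_neq0 (F : fieldType) (I J K N : nat)
    (A : 'M[F]_(I, N)) (B : 'M[F]_(J, N)) (C : 'M[F]_(K, N)) i :
  nonzero_cols A -> nonzero_cols B -> nonzero_cols C -> term A B C i != 0.
Proof.
move=> /(_ i)/cV0Pn[p nza] /(_ i)/cV0Pn[q nzb] /(_ i)/cV0Pn[r nzc].
apply/eqP=> /ffunP/(_ (p, q, r)); rewrite !ffunE /= => /eqP.
by apply/negP; rewrite !mulf_neq0.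
Qed.

(** * Comparing two decompositions by concatenation *)

Definition left_part (m n : nat) : {set 'I_(m + n)} := [set i : 'I_(m + n) | (i < m)%N].

(** The redundant [setT] matches [balanced_vanishing] at [E := setT]. *)
Lemma big_left_part (m n : nat) (V : Type) (x : V) (op : Monoid.com_law x)
    (f : 'I_(m + n) -> V) :
  \big[op/x]_(i in setT :&: left_part m n) f i = \big[op/x]_(i < m) f (lshift n i).
Proof.
rewrite big_mkcond big_split_ord /= [X in op _ X]big1 ?Monoid.mulm1 => [|i _].
  by apply: eq_bigr => i _; rewrite !inE /= ltn_ord.
by rewrite !inE /= ltnNge leq_addr.
Qed.

Lemma big_right_part (m n : nat) (V : Type) (x : V) (op : Monoid.com_law x)
    (f : 'I_(m + n) -> V) :
  \big[op/x]_(i in setT :\: left_part m n) f i = \big[op/x]_(i < n) f (rshift m i).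
Proof.
rewrite big_mkcond big_split_ord /= [X in op X _]big1 ?Monoid.mul1m => [|i _].
  by apply: eq_bigr => i _; rewrite !inE /= -leqNgt leq_addr.
by rewrite !inE /= ltn_ord.
Qed.

Lemma rk_row_mx (F : fieldType) (I m n : nat) (A : 'M[F]_(I, m)) (A' : 'M[F]_(I, n))
    (X : {set 'I_(m + n)}) :
  (rk [set i | lshift n i \in X] A^T <= rk X (row_mx A A')^T)%N.
Proof.
apply: mxrankS; apply/row_subP=> i.
have -> : row i (restr F [set i | lshift n i \in X] *m A^T)
        = row (lshift n i) (restr F X *m (row_mx A A')^T).
  by apply/rowP=> j; rewrite [LHS]mxE [RHS]mxE !restr_mulE inE !mxE (unsplitK (inl i)).
exact: row_sub.
Qed.

Lemma card_left_subset (m n : nat) (X : {set 'I_(m + n)}) :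
  X \subset left_part m n -> #|[set i | lshift n i \in X]| = #|X|.
Proof.
move=> /setIidPl sX; rewrite -[in RHS]sX.
rewrite -!sum1_card [RHS]big_mkcond big_split_ord /= [X in (_ = _ + X)%N]big1 => [|i _].
  rewrite addn0 big_mkcond; apply: eq_bigr => i _.
  by rewrite !inE /= ltn_ord ?andbT.
by rewrite !inE /= ltnNge leq_addr ?andbF.
Qed.

Lemma kruskal_terms (F : fieldType) (I J K R R' : nat)
    (A : 'M[F]_(I, R)) (B : 'M[F]_(J, R)) (C : 'M[F]_(K, R))
    (A' : 'M[F]_(I, R')) (B' : 'M[F]_(J, R')) (C' : 'M[F]_(K, R')) :
  (forall X : {set 'I_R}, (1 < #|X|)%N ->
    (2 * #|X| + 2 <= rk X A^T + rk X B^T + rk X C^T)%N) ->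
  (forall i, term A B C i != 0) -> (forall i, term A' B' C' i != 0) ->
  \sum_i term A B C i = \sum_i term A' B' C' i -> (R' <= R)%N ->
  R' = R /\ forall t,
    (\sum_i (term A B C i == t) = \sum_i (term A' B' C' i == t))%N.
Proof.
move=> condX nz nz' eq_sum leR.
(* The sign placed on [C'] turns equality of the two sums into one vanishing sum. *)
pose A2 := row_mx A A'; pose B2 := row_mx B B'; pose C2 := row_mx C (- C').
have termL i : term A2 B2 C2 (lshift R' i) = term A B C i.
  by rewrite /term !colKl.
have termR i : term A2 B2 C2 (rshift R i) = - term A' B' C' i.
  by rewrite /term !colKr; apply/ffunP=> p; rewrite !ffunE !mxE mulrN.
have nz2 i : term A2 B2 C2 i != 0.
  by case: (split_ordP i) => j ->; rewrite ?termL ?termR ?oppr_eq0.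
pose L := left_part R R'.
have split_sum (E : {set 'I_(R + R')}) : \sum_(i in E) term A2 B2 C2 i = 0 ->
    (1 < #|E :&: L|)%N -> (#|E :\: L| <= #|E :&: L|)%N ->
    exists S : {set 'I_(R + R')},
      [/\ S != set0, S \proper E & \sum_(i in S) term A2 B2 C2 i = 0].
  move=> sumE gt1 leE.
  pose P (S : {set 'I_(R + R')}) :=
    [&& S != set0, S \proper E & \sum_(i in S) term A2 B2 C2 i == 0].
  have [/existsP[S /and3P[nzS pS /eqP sumS]] | /existsPn noS] := boolP [exists S, P S].
    by exists S.
  have E0 : E != set0 by apply: contraTneq gt1 => ->; rewrite set0I cards0.
  have := @rk_minimal_vanishing _ _ _ _ _ E A2 B2 C2 E0 (fun i _ => nz2 i) sumE.
  have minE S : S != set0 -> S \proper E -> \sum_(i in S) term A2 B2 C2 i != 0.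
    by move=> nzS pS; have := noS S; rewrite /P nzS pS.
  move=> /(_ minE).
  have := condX [set i | lshift R' i \in E :&: L].
  rewrite card_left_subset ?subsetIr // => /(_ gt1).
  have := rk_row_mx A A' (E :&: L); have := rk_row_mx B B' (E :&: L).
  have := rk_row_mx C (- C') (E :&: L).
  have := rkS A2^T (subsetIl E L); have := rkS B2^T (subsetIl E L).
  have := rkS C2^T (subsetIl E L); have := cardsID L E; move: leE.
  rewrite -/A2 -/B2 -/C2.
  (* Minimality bounds the three ranks by [#|E| + 1], hence by [2 * #|E :&: L| + 1], one less than
     [condX] demands. *)
  have arith (cL cD cE a0 b0 c0 a1 b1 c1 a b c : nat) : (cD <= cL -> cL + cD = cE ->
    c1 <= c -> b1 <= b -> a1 <= a -> c0 <= c1 -> b0 <= b1 -> a0 <= a1 ->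
    2 * cL + 2 <= a0 + b0 + c0 -> a + b + c <= cE + 1 -> False)%N by clear; lia.
  move=> h1 h2 h3 h4 h5 h6 h7 h8 h9 h10.
  by case: (arith _ _ _ _ _ _ _ _ _ _ _ _ h1 h2 h3 h4 h5 h6 h7 h8 h9 h10).
have := balanced_vanishing nz2 split_sum (E := setT).
have cL : #|setT :&: L| = R by rewrite -sum1_card big_left_part sum1_card card_ord.
have cD : #|setT :\: L| = R' by rewrite -sum1_card big_right_part sum1_card card_ord.
rewrite cL cD (big_setID L) /= big_left_part big_right_part.
under eq_bigr => i _ do rewrite termL.
under [X in _ + X]eq_bigr => i _ do rewrite termR.
rewrite sumrN eq_sum subrr => /(_ erefl leR)[eqR cnt]; split=> // t.
have := cnt t; rewrite big_left_part big_right_part => cnt_t.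
transitivity (\sum_(i < R) (term A2 B2 C2 (lshift R' i) == t))%N.
  by apply: eq_bigr => i _; rewrite termL.
by rewrite cnt_t; apply: eq_bigr => i _; rewrite termR eqr_opp.
Qed.

(** * Permutation and scaling matrices from matched terms *)

Lemma perm_of_count (T : eqType) (n : nat) (x y : 'I_n -> T) :
  (forall t, (\sum_i (x i == t) = \sum_i (y i == t))%N) ->
  exists s : 'S_n, forall i, x i = y (s i).
Proof.
move=> eq_cnt.
have count_codom (f : 'I_n -> T) t :
    (count_mem t [tuple f i | i < n] = \sum_i (f i == t))%N.
  by rewrite -sum1_count big_map big_mkcond /= big_enum_cond.
have /tuple_permP[s sE] : perm_eq [tuple x i | i < n] [tuple y i | i < n].
  by apply/allP=> t _ /=; rewrite !count_codom eq_cnt.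
exists s => i.
have := congr1 (fun u => nth (x i) u i) sE.
by rewrite -!tnth_nth !tnth_mktuple.
Qed.

Lemma CPD_unique_of_terms (F : fieldType) (I J K R : nat)
    (A A' : 'M[F]_(I, R)) (B B' : 'M[F]_(J, R)) (C C' : 'M[F]_(K, R)) (s : 'S_R) :
  nonzero_cols A -> nonzero_cols B -> nonzero_cols C ->
  (forall i, term A' B' C' i = term A B C (s i)) ->
  exists P LA LB LC : 'M[F]_R,
      [/\ is_perm_mx P,
          [/\ nonsingular_diag LA, nonsingular_diag LB & nonsingular_diag LC],
          [/\ A' = A *m P *m LA, B' = B *m P *m LB & C' = C *m P *m LC] &
          LA *m LB *m LC = 1%:M].
Proof.
move=> nzA nzB nzC eq_term.
have [x xE] := fin_all_exists (fun i =>
  outer_inj (nzA (s i)) (nzB (s i)) (nzC (s i)) (esym (eq_term i))).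
have x_neq0 i : [/\ (x i).1.1 != 0, (x i).1.2 != 0 & (x i).2 != 0].
  have [_ _ _ x1] := xE i; have := oner_neq0 F.
  by rewrite -x1 !mulf_eq0 !negb_or -andbA => /and3P[].
have diag_ok (d : 'rV[F]_R) : (forall i, d 0 i != 0) -> nonsingular_diag (diag_mx d).
  move=> nzd; split; first exact: diag_mx_is_diag.
  by rewrite unitmxE unitfE det_diag; apply/prodf_neq0 => i _.
have scaleE m (M M' : 'M[F]_(m, R)) (d : 'rV[F]_R) :
    (forall i, col i M' = d 0 i *: col (s i) M) ->
    M' = M *m perm_mx s^-1 *m diag_mx d.
  move=> eqM; apply/matrixP=> p i; have /colP/(_ p) := eqM i.
  by rewrite -col_permE mul_mx_diag !mxE mulrC.
(* The inverse appears because column [i] of [M *m perm_mx s^-1] is column [s i] of [M]. *)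
exists (perm_mx s^-1), (diag_mx (\row_i (x i).1.1)), (diag_mx (\row_i (x i).1.2)),
  (diag_mx (\row_i (x i).2)).
split; first exact: perm_mx_is_perm.
- by split; apply: diag_ok => i; rewrite mxE; have [] := x_neq0 i.
- by split; apply: scaleE => i; rewrite mxE; have [] := xE i.
- rewrite !mulmx_diag -diag_const_mx; congr diag_mx; apply/rowP=> i; rewrite !mxE.
  by have [] := xE i.
Qed.

Theorem corollary1p30
  (Re : realType) (F : fieldType) (hF : real_or_complex Re F)
  (I J K R : nat) (T : tensor F I J K)
  (A : 'M[F]_(I, R)) (B : 'M[F]_(J, R)) (C : 'M[F]_(K, R))
  (hT : is_PD T A B C)
  (hA : (2 * R + 2 <= krank A + \rank B + \rank C)%N)
  (hB : (2 * R + 2 <= \rank A + krank B + \rank C)%N)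
  (hC : (2 * R + 2 <= \rank A + \rank B + krank C)%N) :
  tensor_rank_is T R /\ CPD_unique T R.
Proof.
have condX := rk_subset_bound hA hB hC.
have [nzA nzB nzC TE] := hT.
have match_PD R' (A' : 'M[F]_(I, R')) (B' : 'M[F]_(J, R')) (C' : 'M[F]_(K, R')) :
      is_PD T A' B' C' -> (R' <= R)%N -> R' = R /\ forall t,
      (\sum_i (term A B C i == t) = \sum_i (term A' B' C' i == t))%N.
  move=> [nzA' nzB' nzC' TE'].
  apply: kruskal_terms => //; try by move=> i; apply: term_neq0.
  by rewrite -[LHS]TE.
split.
  split=> [|R' [A' [B' [C' PD']]]]; first by exists A, B, C.
  (* [match_PD] would force a strictly shorter decomposition to have length [R]. *)
  rewrite leqNgt; apply/negP=> ltR.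
  by have [eqR _] := match_PD _ _ _ _ PD' (ltnW ltR); rewrite eqR ltnn in ltR.
move=> A1 A2 B1 B2 C1 C2 PD1 PD2.
(* The rank hypotheses concern only [A], [B], [C], so each decomposition is matched with these and
   the counts are composed. *)
have [_ cnt1] := match_PD _ _ _ _ PD1 (leqnn R).
have [_ cnt2] := match_PD _ _ _ _ PD2 (leqnn R).
have [s sE] : exists s : 'S_R, forall i, term A2 B2 C2 i = term A1 B1 C1 (s i).
  by apply: perm_of_count => t; rewrite -cnt1 -cnt2.
by have [nzA1 nzB1 nzC1 _] := PD1; apply: CPD_unique_of_terms sE.
Qed.
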